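(* Let $d,k\ge 0$ and $r\ge 2$ be integers, and let $K\subseteq L$ be finite simplicial complexes such that for every continuous map $F\colon L\to\mathbb{R}^{d+k}$ there are $r$ pairwise disjoint faces $\sigma_1,\dots,\sigma_r$ of $L$ with $F(\sigma_1)\cap\dots\cap F(\sigma_r)\neq\emptyset$. Suppose $\chi(\mathrm{KG}^r(K,L))\le k$. Then for every continuous map $f\colon K\to\mathbb{R}^d$ there are $r$ pairwise disjoint faces $\sigma_1,\dots,\sigma_r$ of $K$ such that $f(\sigma_1)\cap\dots\cap f(\sigma_r)\neq\emptyset$.
   Context: Continuous maps on a simplicial complex are maps on its geometric realization; $f(\sigma)$ is the image of the closed simplex $\sigma$; faces are pairwise disjoint if their vertex sets are pairwise disjoint. For a simplicial complex $L$, a subcomplex $K\subseteq L$ and an integer $r\ge2$, the generalized Kneser hypergraph $\mathrm{KG}^r(K,L)$ is the $r$-uniform hypergraph whose vertices are the inclusion-minimal faces of $L$ that are not faces of $K$, with $r$ such vertices forming a hyperedge exactly when the corresponding faces are pairwise disjoint. A $k$-coloring of a hypergraph is a map $c$ from its vertices to $\{1,\dots,k\}$ such that every hyperedge contains two vertices $v,w$ with $c(v)\neq c(w)$; the chromatic number $\chi$ is the least $k$ for which a $k$-coloring exists. *)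

(* Defs.v *)
From HB Require Import structures.
From mathcomp Require Import all_boot all_order all_algebra.
From mathcomp Require Import all_classical all_reals all_analysis.

Set Implicit Arguments.
Unset Strict Implicit.
Unset Printing Implicit Defensive.

Import Order.TTheory GRing.Theory Num.Theory.
Import numFieldNormedType.Exports.

Local Open Scope classical_set_scope.
Local Open Scope ring_scope.

(* Every complex has the empty face; points of [V] need not be vertices. *)
Record simplicial_complex (V : finType) := SimplicialComplex {
  faces : {set {set V}};
  face0 : finset.set0 \in faces;
  face_sub : forall s t : {set V}, s \in faces -> t \subset s -> t \in faces
}.

Section GeometricRealization.
Variables (R : realType) (V : finType).
Implicit Types (K : simplicial_complex V) (s : {set V}).

(* Points are given by barycentric coordinates in the product space R^V. *)
Definition closed_simplex s : set {ptws V -> R} :=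
  [set x | [/\ forall v, 0 <= x v, \sum_v x v = 1
             & forall v, v \notin s -> x v = 0]].

Definition realization K : set {ptws V -> R} :=
  \bigcup_(s in [set` faces K]) closed_simplex s.

Definition disjoint_faces_meet (r : nat) K (T : Type)
    (f : {ptws V -> R} -> T) : Prop :=
  exists s : 'I_r -> {set V},
    [/\ forall i, s i \in faces K,
        forall i j, i != j -> [disjoint s i & s j]%B
      & \bigcap_(i in [set: 'I_r]) (f @` closed_simplex (s i)) !=set0].

End GeometricRealization.

Record uniform_hypergraph (r : nat) := UniformHypergraph {
  hvertex : finType;
  hedge : {set {set hvertex}};
  hedge_card : forall e : {set hvertex}, e \in hedge -> #|e| = r
}.

Section ChromaticNumber.
Variables (r : nat) (H : uniform_hypergraph r).

Definition is_coloring (k : nat) (c : {ffun hvertex H -> 'I_k}) : bool :=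
  [forall e : {set hvertex H}, (e \in hedge H) ==>
    [exists v : hvertex H, exists w : hvertex H,
      [&& v \in e, w \in e & c v != c w]]].

Definition colorable (k : nat) : bool :=
  [exists c : {ffun hvertex H -> 'I_k}, is_coloring c].

Lemma colorable_card : (1 < r)%N -> colorable #|hvertex H|.
Proof.
move=> r_gt1; apply/existsP; exists [ffun v => enum_rank v].
apply/forallP => e; apply/implyP => /hedge_card e_r.
have /card_gt1P[v [w [ve we vw]]] : (1 < #|e|)%N by rewrite e_r.
apply/existsP; exists v; apply/existsP; exists w.
by rewrite ve we !ffunE (inj_eq enum_rank_inj).
Qed.

Lemma colorable_ex : (1 < r)%N -> exists k, colorable k.
Proof. by move=> /colorable_card; exists #|hvertex H|. Qed.

End ChromaticNumber.

Definition chromatic_number (r : nat) (r_gt1 : (1 < r)%N)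
    (H : uniform_hypergraph r) : nat :=
  ex_minn (colorable_ex H r_gt1).

Section Kneser.
Variables (V : finType) (K L : simplicial_complex V).

Definition minimal_nonface (s : {set V}) : bool :=
  minset (fun t : {set V} => (t \in faces L) && (t \notin faces K)) s.

Definition kneser_vertex : finType := {s : {set V} | minimal_nonface s}.

Definition kneser_edges (r : nat) : {set {set kneser_vertex}} :=
  [set e : {set kneser_vertex} | (#|e| == r) &&
    [forall s in e, forall t in e,
       (s != t) ==> [disjoint val s & val t]%B]]%SET.

Lemma kneser_edges_card (r : nat) (e : {set kneser_vertex}) :
  e \in kneser_edges r -> #|e| = r.
Proof. by rewrite inE => /andP[/eqP]. Qed.

Definition kneser_hypergraph (r : nat) : uniform_hypergraph r :=
  UniformHypergraph (@kneser_edges_card r).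

End Kneser.

(* Main.v *)
(** Extend [f] to [g : L -> R^d] by Tietze, and for every colour [a] of a
    colouring of the Kneser hypergraph let [q_a : L -> R] be the sum, over the
    minimal nonfaces [s] of colour [a], of the product of the barycentric
    coordinates indexed by [s].  Points [x_i] of disjoint faces of [L] with equal
    image under [(g, q)] may be taken with their supports as faces.  If some
    [x_i] were outside [K], then some [q_a] would be nonzero at every [x_i], so
    all the supports would contain minimal nonfaces of colour [a]: a
    monochromatic hyperedge.  Hence all [x_i] lie in [K], where [g = f]. *)

Require Import Defs.
From mathcomp Require Import all_boot all_order all_algebra.
From mathcomp Require Import all_classical all_reals all_analysis.

Set Implicit Arguments.
Unset Strict Implicit.

Import numFieldNormedType.Exports.

Local Open Scope classical_set_scope.
Local Open Scope ring_scope.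

Import Order.TTheory GRing.Theory Num.Theory.

(** A neighbourhood of a matrix contains a product of neighbourhoods of its finitely many entries,
    so the entrywise filter conditions can be intersected. *)
Lemma mx_continuous (T U : topologicalType) (m n : nat) (f : T -> 'M[U]_(m, n)) :
  (forall i j, continuous (fun x => f x i j)) -> continuous f.
Proof.
move=> f_cont x A [P nP PA]; rewrite nbhs_simpl /=.
apply: (@filterS _ _ _ (fun y => forall i j, P i j (f y i j))).
  by move=> y Py; exact: PA.
apply: filter_forall => i; apply: filter_forall => j.
exact: (f_cont i j x _ (nP i j)).
Qed.

(** * Compactness of the realization, Tietze extension, supports *)

Section GeometricRealizationTopology.
Variables (R : realType) (V : finType).
Implicit Types (K : simplicial_complex V) (s : {set V}).

Lemma eval_continuous (v : V) : continuous (fun x : {ptws V -> R} => x v).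
Proof. exact: (@proj_continuous _ (fun=> R : topologicalType) v). Qed.

(** Nonnegative coordinates with sum 1 lie in [[0, 1]], so the simplex is a closed subset of a cube,
    which is compact by Tychonoff. *)
Lemma closed_simplex_compact s :
  compact (@closed_simplex R V s : set {ptws V -> R}).
Proof.
have cube : compact [set x : {ptws V -> R} | forall v, `[0, 1]%classic (x v)].
  by apply: (@tychonoff V (fun=> R : topologicalType) (fun=> `[0, 1]%classic));
    move=> v; exact: segment_compact.
apply: (subclosed_compact _ cube) => [|x [x_ge0 x_sum _] v]; last first.
  rewrite /= in_itv /= x_ge0 -x_sum (bigD1 v) //= lerDl.
  by apply: sumr_ge0 => w _; exact: x_ge0.
have -> : @closed_simplex R V s =
    (\bigcap_(v in [set: V]) [set x : {ptws V -> R} | 0 <= x v]) `&`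
    [set x : {ptws V -> R} | \sum_v x v = 1] `&`
    (\bigcap_(v in [set v | v \notin s]) [set x : {ptws V -> R} | x v = 0]).
  apply/seteqP; split => [x [x0 ? xs]|x [[x0 ?] xs]].
    by split; [split => // v _; exact: x0|exact: xs].
  by split => [v||v]; [exact: x0| |exact: xs].
apply: closedI; [apply: closedI|].
- apply: closed_bigI => v _.
  exact: (preimage_closed (in1W (@eval_continuous v)) (@closed_ge R 0)).
- apply: (@preimage_closed _ _ (fun x : {ptws V -> R} => \sum_v x v) [set 1]).
    apply: in1W; apply: (@continuous_big R V _ _ _ add_continuous) => v _.
    exact: eval_continuous.
  exact: (@closed_eq R 1).
- apply: closed_bigI => v _.
  exact: (preimage_closed (in1W (@eval_continuous v)) (@closed_eq R 0)).
Qed.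

Lemma realization_compact K : compact (realization K : set {ptws V -> R}).
Proof.
rewrite /realization -bigsetU_fset_set; last exact: finite_finset.
by apply: bigsetU_compact => s _; exact: closed_simplex_compact.
Qed.

Lemma realization_closed K : closed (realization K : set {ptws V -> R}).
Proof.
apply: compact_closed (@realization_compact K).
by apply: (@hausdorff_product V (fun=> R : topologicalType)) => v; exact: Rhausdorff.
Qed.

(** Bounded Tietze extension applies: the realization is compact, so it is closed and [f] is bounded
    on it, and the ambient space is normal. *)
Lemma realization_extension K (f : {ptws V -> R} -> R) :
  {within realization K, continuous f} ->
  exists2 g : {ptws V -> R} -> R, continuous g & {in realization K, f =1 g}.
Proof.
move=> f_cont.
have /compact_bounded [M [_ fM]] :
    compact (f @` realization K : set (R^o : normedModType R)).
  exact: continuous_compact f_cont (@realization_compact K).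
have normal_ptws : normal_space {ptws V -> R} by exact: (@pseudometric_normal R).
(* The bound holds for every real above [M], and Tietze needs a positive one; this value is both. *)
have M1 : 0 < `|M| + 1 by rewrite ltr_wpDl.
have fM1 x : realization K x -> `|f x| <= `|M| + 1.
  have M_lt : M < `|M| + 1 by rewrite (le_lt_trans (ler_norm M)) ?ltrDl.
  by move=> Kx; apply: (fM _ M_lt (f x)); exists x.
have [g [fg g_cont _]] :=
  continuous_bounded_extension normal_ptws (@realization_closed K) M1 f_cont fM1.
by exists g.
Qed.

Lemma realization_extension_rV K d (f : {ptws V -> R} -> 'rV[R]_d) :
  {within realization K, continuous f} ->
  exists2 g : {ptws V -> R} -> 'rV[R]_d,
    continuous g & {in realization K, f =1 g}.
Proof.
move=> f_cont.
have coord_ext (j : 'I_d) : exists g : {ptws V -> R} -> R,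
    continuous g /\ {in realization K, (fun x => f x ord0 j) =1 g}.
  have [|g ? ?] := @realization_extension K (fun x => f x ord0 j); last by exists g.
  move=> x.
  apply: (continuous_comp (g := fun A : 'rV[R]_d => A ord0 j) (f_cont x)).
  exact: coord_continuous.
pose g j := projT1 (cid (coord_ext j)).
exists (fun x => \row_j g j x) => [|x Kx].
  apply: mx_continuous => i j.
  rewrite (_ : (fun _ => _) = g j); last by apply/funext => x; rewrite mxE.
  by have [] := projT2 (cid (coord_ext j)).
apply/rowP => j; rewrite mxE.
by have [_ ->] := projT2 (cid (coord_ext j)).
Qed.

Definition support (x : {ptws V -> R}) : {set V} := [set v | x v != 0]%SET.

Lemma support_sub s x : closed_simplex s x -> support x \subset s.
Proof.
move=> [_ _ xs]; apply/fintype.subsetP => v; rewrite inE.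
by apply: contraNT => /xs ->.
Qed.

Lemma closed_simplex_support s x :
  closed_simplex s x -> closed_simplex (support x) x.
Proof.
by move=> [x_ge0 x_sum _]; split=> // v; rewrite inE negbK => /eqP.
Qed.

Lemma prod_eq0_support s (x : {ptws V -> R}) :
  (\prod_(v in s) x v == 0) = ~~ (s \subset support x).
Proof.
apply/idP/idP => [/prodf_eq0 [v vs xv0]|/fintype.subsetPn[v vs]].
  by apply/fintype.subsetPn; exists v => //; rewrite inE xv0.
by rewrite inE negbK => xv0; apply/prodf_eq0; exists v.
Qed.

End GeometricRealizationTopology.

(** * Minimal nonfaces and their colours *)

Section ColorDefect.
Variables (R : realType) (V : finType) (K L : simplicial_complex V).
Variables (m : nat) (c : kneser_vertex K L -> 'I_m).

(** The colour is a natural number so that it may exceed the range of [c]; the sum is then empty. *)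
Definition color_defect (a : nat) (x : {ptws V -> R}) : R :=
  \sum_(s : kneser_vertex K L | c s == a :> nat) \prod_(v in val s) x v.

Lemma color_defect_continuous a : continuous (color_defect a).
Proof.
apply: (@continuous_big R _ _ _ _ add_continuous) => s _.
apply: (@continuous_big R _ _ _ _ mul_continuous) => v _.
exact: eval_continuous.
Qed.

(** Barycentric coordinates are nonnegative, so the summands cannot cancel, and a product is
    positive exactly when its nonface lies in the support. *)
Lemma color_defect_neq0 a s x : closed_simplex s x ->
  reflect (exists2 u : kneser_vertex K L, c u == a :> nat &
             val u \subset support x)
          (color_defect a x != 0).
Proof.
move=> [x_ge0 _ _]; rewrite /color_defect psumr_neq0; last first.
  by move=> u _; apply: prodr_ge0 => v _; exact: x_ge0.
apply: (iffP hasP) => [[u _ /andP[cu]]|[u cu ux]].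
  by move=> /gt_eqF; rewrite prod_eq0_support => /negbFE ux; exists u.
exists u; first by rewrite mem_index_enum.
rewrite cu lt0r prod_eq0_support negbK ux /=.
by apply: prodr_ge0 => v _; exact: x_ge0.
Qed.

End ColorDefect.

Lemma minimal_nonface_exists (V : finType) (K L : simplicial_complex V)
    (s : {set V}) :
  s \in faces L -> s \notin faces K ->
  exists u : kneser_vertex K L, val u \subset s.
Proof.
move=> sL sK.
have [u u_min us] := @minset_exists V
  (fun t : {set V} => (t \in faces L) && (t \notin faces K)) s
  (introT andP (conj sL sK)).
by exists (exist _ u u_min).
Qed.

(** The empty set is a face of [K]. *)
Lemma minimal_nonface_neq0 (V : finType) (K L : simplicial_complex V)
    (u : kneser_vertex K L) : exists v, v \in val u.
Proof.
apply/set0Pn; apply/eqP => u0.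
by have := minsetp (valP u); rewrite /= u0 !face0.
Qed.

(** Disjoint nonempty sets are distinct, so the family has exactly [r] members and forms a
    hyperedge. *)
Lemma coloring_disjoint (V : finType) (K L : simplicial_complex V) (r m : nat)
    (c : {ffun hvertex (kneser_hypergraph K L r) -> 'I_m})
    (u : 'I_r -> kneser_vertex K L) :
  is_coloring c ->
  (forall i j, i != j -> [disjoint val (u i) & val (u j)]%B) ->
  exists i j, c (u i) != c (u j).
Proof.
move=> /forallP c_col u_disj.
have u_inj : injective u.
  move=> i j uij; apply/eqP/negPn/negP => /u_disj.
  have [v vu] := minimal_nonface_neq0 (u j).
  by rewrite uij => /disjointFr/(_ vu); rewrite vu.
pose e : {set kneser_vertex K L} := [set u i | i : 'I_r]%SET.
have e_edge : e \in @kneser_edges V K L r.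
  rewrite inE card_imset // card_ord eqxx /=.
  apply/forall_inP => _ /imsetP[i _ ->]; apply/forall_inP => _ /imsetP[j _ ->].
  by apply/implyP => uij; apply: u_disj; apply: contraNneq uij => ->.
have /existsP[v /existsP[w /and3P[]]] := implyP (c_col e) e_edge.
by move=> /imsetP[i _ ->] /imsetP[j _ ->] cij; exists i, j.
Qed.

Unset Implicit Arguments.

Theorem theorem4p5 (R : realType) (d k r : nat) (r_gt1 : (1 < r)%N)
    (V : finType) (K L : simplicial_complex V)
    (KL : faces K \subset faces L)
    (L_meet : forall F : {ptws V -> R} -> 'rV[R]_(d + k),
       {within realization L, continuous F} -> disjoint_faces_meet r L F)
    (chi_le : (chromatic_number r_gt1 (kneser_hypergraph K L r) <= k)%N)
    (f : {ptws V -> R} -> 'rV[R]_d)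
    (f_cont : {within realization K, continuous f}) :
  disjoint_faces_meet r K f.
Proof.
move: chi_le; rewrite /chromatic_number.
case: ex_minnP => m /existsP[c c_col] _ le_mk.
have [g g_cont fg] := realization_extension_rV f_cont.
(* Since [m <= k], the entries from [m] on are zero and pad the target to dimension [d + k]. *)
pose q x : 'rV[R]_k := \row_a color_defect c a x.
have F_cont : continuous (fun x => row_mx (g x) (q x)).
  apply: mx_continuous => i j; rewrite -(splitK j).
  case: (fintype.split j) => j' /=.
    rewrite (_ : (fun _ => _) = fun x => g x i j'); last first.
      by apply/funext => x; rewrite row_mxEl.
    move=> x; apply: (continuous_comp (g := fun A : 'rV[R]_d => A i j') (g_cont x)).
    exact: coord_continuous.
  rewrite (_ : (fun _ => _) = color_defect c j'); last first.
    by apply/funext => x; rewrite row_mxEr mxE.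
  exact: color_defect_continuous.
have [s [sL s_disj [y y_meet]]] := L_meet _ (continuous_subspaceT F_cont).
have x_ex i : exists x, closed_simplex (s i) x /\ row_mx (g x) (q x) = y.
  by have [x] := y_meet i I; exists x.
pose x i := projT1 (cid (x_ex i)).
have xs i : closed_simplex (s i) (x i) by have [] := projT2 (cid (x_ex i)).
have xy i : row_mx (g (x i)) (q (x i)) = y by have [] := projT2 (cid (x_ex i)).
have t_disj i j : i != j -> [disjoint support (x i) & support (x j)]%B.
  by move=> /s_disj; apply: disjointW; exact: support_sub.
have tK i : support (x i) \in faces K.
  apply/negPn/negP => tiK.
  have tiL := face_sub (sL i) (support_sub (xs i)).
  have [u0 u0t] := minimal_nonface_exists tiL tiK.
  have u_ex j : exists u : kneser_vertex K L, c u = c u0 /\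
      val u \subset support (x j).
    have a_lt : (c u0 < k)%N := leq_trans (ltn_ord _) le_mk.
    (* All the points share this coordinate of [y], so nonvanishing passes from [x i] to every
       [x j]. *)
    have qE l : color_defect c (c u0) (x l) =
        y ord0 (rshift d (Ordinal a_lt)).
      by rewrite -(xy l) row_mxEr mxE.
    have : color_defect c (c u0) (x j) != 0.
      rewrite qE -(qE i); apply/(color_defect_neq0 _ _ (xs i)).
      by exists u0.
    move=> /(color_defect_neq0 _ _ (xs j))[u /eqP cu ux].
    by exists u; split => //; exact/val_inj.
  pose u j := projT1 (cid (u_ex j)).
  (* The [u j] inherit disjointness from the supports, yet all have the colour of [u0]. *)
  have [j l uj|j [l]] := coloring_disjoint (u := u) c_col.
    apply: disjointW (t_disj _ _ uj).
      by have [] := projT2 (cid (u_ex j)).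
    by have [] := projT2 (cid (u_ex l)).
  have [-> _] := projT2 (cid (u_ex j)); have [-> _] := projT2 (cid (u_ex l)).
  by rewrite eqxx.
exists (fun i => support (x i)); split => //.
(* The first [d] coordinates of [y] are the common value of [g], which is [f] on the realization of
   [K]. *)
exists (lsubmx y) => i _; exists (x i); first exact: closed_simplex_support (xs i).
rewrite fg ?inE; first by rewrite -(xy i) row_mxKl.
by exists (support (x i)); [exact: tK|exact: closed_simplex_support (xs i)].
Qed.
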